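(* Let the fundamental diagram be triangular, let $x_m=x_0+m\Delta x$ for $m\in\{0,\dots,n_{ini}\}$, and let $\Delta t\le\frac{\Delta x}{v}$. For any discrete time $t=i\cdot\Delta t$ with $i\in\mathbb{N}$, $i\ge1$, we have $$N(x_0,t)=\begin{cases}\min\left(N_{c_{ini}^{l}}(x_0,t),\,N_{c_{ini}^{l-1}}(x_0,t),\,N_{c_{up}^{j}}(x_0,(i-1)\Delta t)+v\,k_c\,\Delta t\right) & \text{if } t\le\frac{x_{n_{ini}}-x_0}{w},\\[1ex] \min\left(N_{c_{up}^{j}}(x_0,(i-1)\Delta t)+v\,k_c\,\Delta t,\,N_{c_{down}^{k}}(x_0,t)\right) & \text{otherwise,}\end{cases}$$ where $j=i-1$, $k=\left\lfloor\frac{t-\frac{x_{n_{ini}}-x_0}{w}}{\Delta t}\right\rfloor$ and $l=\left\lfloor\frac{wt}{\Delta x}\right\rfloor$.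
   Context: Triangular fundamental diagram: $Q(k)=vk$ for $0\le k\le k_c$ and $Q(k)=-w(k-k_{jam})$ for $k_c\le k\le k_{jam}$, with $v,w>0$, $0<k_c<k_{jam}$ and $vk_c=-w(k_c-k_{jam})$. Its convex transform is $R(u)=\sup_{k\in[0,k_{jam}]}(Q(k)-uk)=k_c(v-u)$ for $u\in[-w,v]$. The road link is $[x_0,x_{n_{ini}}]$; $\Delta x,\Delta t>0$ are the space and time steps. Initial blocks, imposed at time $0$: for $m\in\{0,\dots,n_{ini}-1\}$, $c_{ini}^m(x)=-k_mx+b_m$ on $[x_m,x_{m+1}]$ and $+\infty$ otherwise, with $0\le k_m\le k_{jam}$ and $c_{ini}^m(x_{m+1})=c_{ini}^{m+1}(x_{m+1})$. With $t_m=m\Delta t$, $m\ge0$, the upstream blocks (imposed at $x_0$) are $c_{up}^m(t)=q_mt+d_m$ and the downstream blocks (imposed at $x_{n_{ini}}$) are $c_{down}^m(t)=p_mt+c_m$ on $[t_m,t_{m+1}]$, $+\infty$ otherwise, with $0\le q_m,p_m\le vk_c$. Initial, upstream and downstream data together are continuous (consecutive blocks agree at common endpoints, and boundary data agree with the initial data at time $0$ at $x_0$ and $x_{n_{ini}}$). For data $c$ prescribed on a set of points $(y,s)$ of the boundary of the space-time domain, the associated solution component is given by the Lax-Hopf formula $$N_c(x,t)=\inf\{c(y,s)+(t-s)R(\tfrac{x-y}{t-s}) : (y,s)\in\mathrm{Dom}(c),\ s<t,\ -w\le\tfrac{x-y}{t-s}\le v\},$$ where also $(y,s)=(x,t)$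 is admitted, with value $c(x,t)$, if $(x,t)\in\mathrm{Dom}(c)$; the infimum over the empty set is $+\infty$. In particular $N_{c_{ini}^m}$, $N_{c_{up}^m}$, $N_{c_{down}^m}$ are the components of single blocks; components with an index outside the range of existing blocks are taken to be $+\infty$. $N(x_0,i\Delta t)$ is the value used to compute the supply of the link over $[(i-1)\Delta t,i\Delta t]$, when the upstream flow over this last interval is not yet prescribed: it is the minimum of the components at $(x_0,i\Delta t)$ of all initial blocks, of all downstream data, and of the upstream data restricted to times $[0,(i-1)\Delta t]$. The prescribed upstream flows are the actual flows given by a junction model and so never exceed the supply: $c_{up}(m\Delta t)\le N(x_0,m\Delta t)$ for all $m\ge1$. Likewise downstream flows never exceed the demand: $c_{down}(m\Delta t)$ is at most the minimum of the components at $(x_{n_{ini}},m\Delta t)$ of all initial blocks, all upstream data, and the downstream data restricted to $[0,(m-1)\Delta t]$.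
   Formalization: The formal theorem also assumes Δt ≤ Δx/w (automatic from Δt ≤ Δx/v when w ≤ v); without it the claim fails, e.g. v=1, w=3, k_c=1, k_jam=4/3, Δx=Δt=1, three initial blocks with densities 4/3, 0, 0, zero boundary flows, i=1. *)

(* Defs.v *)
From HB Require Import structures.
From mathcomp Require Export all_boot all_order all_algebra.
From mathcomp Require Export all_classical all_reals ereal.

Set Implicit Arguments.
Unset Strict Implicit.
Unset Printing Implicit Defensive.

Import Order.TTheory GRing.Theory Num.Theory.
Local Open Scope classical_set_scope.
Local Open Scope ring_scope.

Record fundamental_diagram (R : realType) := FundamentalDiagram {
  fd_v : R;     (* free-flow speed *)
  fd_w : R;     (* absolute value of the congestion wave speed *)
  fd_kc : R;    (* critical density *)
  fd_kjam : R   (* jam density *)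
}.

(* The last clause makes the two branches of [flow] agree at the critical
   density. *)
Definition triangular (R : realType) (F : fundamental_diagram R) : Prop :=
  [/\ 0 < fd_v F, 0 < fd_w F, 0 < fd_kc F, fd_kc F < fd_kjam F
    & fd_v F * fd_kc F = - fd_w F * (fd_kc F - fd_kjam F)].

(* Only used on [0, fd_kjam F]. *)
Definition flow (R : realType) (F : fundamental_diagram R) (k : R) : R :=
  if k <= fd_kc F then fd_v F * k else - fd_w F * (k - fd_kjam F).

Definition convex_transform (R : realType) (F : fundamental_diagram R)
    (u : R) : R :=
  sup [set flow F k - u * k | k in [set k | 0 <= k <= fd_kjam F]].

(* Data are functions of a position and a time, equal to +oo outside of the
   set of points on which they are prescribed. *)
Definition data (R : realType) := R -> R -> \bar R.

Definition Dom (R : realType) (c : data R) (y s : R) : Prop := c y s <> +oo%E.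

Definition component (R : realType) (F : fundamental_diagram R) (c : data R)
    (x t : R) : \bar R :=
  ereal_inf
    ([set z : \bar R | exists y s : R,
        [/\ Dom c y s, s < t, - fd_w F <= (x - y) / (t - s) <= fd_v F
          & z = (c y s + ((t - s) *
                   convex_transform F ((x - y) / (t - s)))%:E)%E]]
     `|` [set z : \bar R | Dom c x t /\ z = c x t]).

Record link_data (R : realType) := LinkData {
  n_ini : nat;
  node : nat -> R;     (* x_m, for m <= n_ini *)
  dt : R;
  ini_k : nat -> R;    (* the initial coefficients matter for m < n_ini only *)
  ini_b : nat -> R;
  up_q : nat -> R;
  up_d : nat -> R;
  down_p : nat -> R;
  down_c : nat -> R
}.

Section Link.
Variables (R : realType) (F : fundamental_diagram R) (D : link_data R).

Definition time (m : nat) : R := m%:R * dt D.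

Definition x_up : R := node D 0%N.
Definition x_down : R := node D (n_ini D).

Definition ini_affine (m : nat) (x : R) : R := - ini_k D m * x + ini_b D m.
Definition up_affine (m : nat) (t : R) : R := up_q D m * t + up_d D m.
Definition down_affine (m : nat) (t : R) : R := down_p D m * t + down_c D m.

Definition ini_block (m : nat) : data R := fun y s =>
  if (s == 0) && (node D m <= y <= node D m.+1) then (ini_affine m y)%:E
  else +oo%E.

Definition up_block (m : nat) : data R := fun y s =>
  if (y == x_up) && (time m <= s <= time m.+1) then (up_affine m s)%:E
  else +oo%E.

Definition down_block (m : nat) : data R := fun y s =>
  if (y == x_down) && (time m <= s <= time m.+1) then (down_affine m s)%:E
  else +oo%E.

Definition admissible_coefficients : Prop :=
  [/\ forall m, (m < n_ini D)%N -> 0 <= ini_k D m <= fd_kjam F,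
      forall m, 0 <= up_q D m <= fd_v F * fd_kc F
    & forall m, 0 <= down_p D m <= fd_v F * fd_kc F].

Definition continuous_data : Prop :=
  [/\ forall m, (m.+1 < n_ini D)%N ->
        ini_affine m (node D m.+1) = ini_affine m.+1 (node D m.+1),
      forall m, up_affine m (time m.+1) = up_affine m.+1 (time m.+1),
      forall m, down_affine m (time m.+1) = down_affine m.+1 (time m.+1),
      up_affine 0%N 0 = ini_affine 0%N x_up
    & down_affine 0%N 0 = ini_affine (n_ini D).-1 x_down].

(* The glued boundary data: under [continuous_data] all the finite values over
   which the infimum is taken coincide. *)
Definition up_data : data R := fun y s =>
  ereal_inf [set up_block m y s | m in [set: nat]].

Definition down_data : data R := fun y s =>
  ereal_inf [set down_block m y s | m in [set: nat]].

Definition until (T : R) (c : data R) : data R := fun y s =>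
  if s <= T then c y s else +oo%E.

(* Blocks are indexed by integers, so that indices outside of the range of
   existing blocks (negative ones included) give +oo. *)
Definition N_ini (m : int) (x t : R) : \bar R :=
  if m is Posz m' then
    if (m' < n_ini D)%N then component F (ini_block m') x t else +oo%E
  else +oo%E.

Definition N_up (m : int) (x t : R) : \bar R :=
  if m is Posz m' then component F (up_block m') x t else +oo%E.

Definition N_down (m : int) (x t : R) : \bar R :=
  if m is Posz m' then component F (down_block m') x t else +oo%E.

Definition N_all_ini (x t : R) : \bar R :=
  \big[Order.min/+oo%E]_(m < n_ini D) component F (ini_block m) x t.

(* For 0 < i, the value N(x_0, i dt) from which the supply over
   [(i-1) dt, i dt] is computed: the upstream data are used up to time
   (i-1) dt only. *)
Definition N_supply (i : nat) : \bar R :=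
  Order.min (N_all_ini x_up (time i))
    (Order.min (component F down_data x_up (time i))
       (component F (until (time i.-1) up_data) x_up (time i))).

Definition N_demand (i : nat) : \bar R :=
  Order.min (N_all_ini x_down (time i))
    (Order.min (component F up_data x_down (time i))
       (component F (until (time i.-1) down_data) x_down (time i))).

Definition flows_from_junctions : Prop :=
  (forall m, (0 < m)%N -> (up_data x_up (time m) <= N_supply m)%E) /\
  (forall m, (0 < m)%N -> (down_data x_down (time m) <= N_demand m)%E).

End Link.

(* Main.v *)
Require Import Defs.
From mathcomp Require Import all_boot all_order all_algebra.
From mathcomp Require Import all_classical all_reals ereal.
From mathcomp Require Import ring lra zify.

Import Order.TTheory GRing.Theory Num.Theory.
Local Open Scope ring_scope.

(** For u in [-w, v] the convex transform is the affine function kc (v - u), so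
    a datum of value c at (y, s) contributes c + kc (v (t - s) - (x - y)) to
    the component at (x, t): the contribution is affine in y and in s, provided
    that (y, s) lies in the backward cone of (x, t).  At x = x_0 this has three
    consequences.

    - An upstream value c_up(s) contributes c_up(s) + kc v (t - s), which is
      nonincreasing in s because q_m <= v kc.  The upstream data up to time
      t_{i-1} thus contribute exactly U = c_up(t_{i-1}) + v kc dt
      ([component_up_until]).
    - For the same reason the downstream data contribute through the latest
      time which can reach x_0, namely t - T with T = (x_n - x_0) / w, hence
      through the block that contains this time ([component_down_block]).
    - An initial value at y contributes c_ini(y) + kc (v t + y - x_0) when
      y - x_0 <= w t.  If moreover y - x_0 <= w t_{i-1}, then the point was
      already in the cone of (x_0, t_{i-1}), and since
      c_up(t_{i-1}) <= N(x_0, t_{i-1}), its contribution is at least U; for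
      i = 1 the point is x_0 and continuity at the corner (x_0, 0) replaces
      this bound ([upstream_le_ini]).  Only the points with
      w t_{i-1} < y - x_0 <= w t remain, and they span at most w dt <= dx.

    If t <= T, these remaining points lie in the blocks l and l - 1, and the
    downstream data contribute nothing, except at t = T, where they contribute
    the value at the corner (x_n, 0), which belongs to the initial block
    n - 1 = l - 1.  If t > T, the remaining points lie in the last block, on
    which the contribution is affine in y.  Hence it is bounded below by its
    value at the left end of the block, which is at least U, or by its value at
    the right end x_n, which is a downstream contribution at time 0
    ([ini_ge_min_up_down]). *)

(** * Components of a triangular diagram *)

Lemma convex_transform_triangular (R : realType) (F : fundamental_diagram R)
    (u : R) (hF : triangular F) (hu : - fd_w F <= u <= fd_v F) :
  convex_transform F u = fd_kc F * (fd_v F - u).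
Proof.
case: hF hu => v0 w0 k0 kj E /andP[wu uv].
have ub : ubound [set flow F k - u * k | k in [set k | 0 <= k <= fd_kjam F]]%classic
    (fd_kc F * (fd_v F - u)).
  move=> _ [k /= /andP[k_ge0 k_jam] <-]; rewrite /flow; case: ifP => kkc.
    by have := mulr_ge0 (_ : 0 <= fd_v F - u) (_ : 0 <= fd_kc F - k); nra.
  have {}kkc : fd_kc F < k by rewrite ltNge kkc.
  by have := mulr_ge0 (_ : 0 <= fd_w F + u) (_ : 0 <= k - fd_kc F); nra.
have mem : [set flow F k - u * k | k in [set k | 0 <= k <= fd_kjam F]]%classic
    (fd_kc F * (fd_v F - u)).
  exists (fd_kc F); first by rewrite /= !ltW.
  by rewrite /flow lexx; ring.
apply/le_anti/andP; split.
  by apply: ge_sup => //; exists (fd_kc F * (fd_v F - u)).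
by apply: ub_le_sup => //; exists (fd_kc F * (fd_v F - u)).
Qed.

(** The case s = t of the cone condition forces y = x and then costs nothing,
    so the two parts of the set defining a component can be treated
    uniformly. *)
Lemma component_le (R : realType) (F : fundamental_diagram R) (c : data R)
    (x t y s : R) (hF : triangular F) (hst : s <= t)
    (hcone : - fd_w F * (t - s) <= x - y <= fd_v F * (t - s)) :
  (component F c x t <=
     c y s + (fd_kc F * (fd_v F * (t - s) - (x - y)))%:E)%E.
Proof.
have [->|cfin] := eqVneq (c y s) +oo%E; first by rewrite leey.
case/andP: hcone => cw cv.
apply: ereal_inf_lbound.
move: hst; rewrite le_eqVlt => /predU1P[st|st].
  have xy : x = y by move: cw cv; rewrite st subrr !mulr0; lra.
  right; rewrite xy -st; split; first exact/eqP.
  by rewrite !subrr mulr0 subrr mulr0 adde0.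
have ts0 : 0 < t - s by rewrite subr_gt0.
have cone : - fd_w F <= (x - y) / (t - s) <= fd_v F.
  by rewrite ler_pdivlMr // ler_pdivrMr // cw.
left; exists y, s; split => //; first exact/eqP.
rewrite convex_transform_triangular //; congr (_ + _%:E)%E.
by field; rewrite gt_eqF.
Qed.

Lemma component_ge (R : realType) (F : fundamental_diagram R) (c : data R)
    (x t : R) (B : \bar R) (hF : triangular F)
    (hB : forall y s, s <= t ->
       - fd_w F * (t - s) <= x - y <= fd_v F * (t - s) ->
       (B <= c y s + (fd_kc F * (fd_v F * (t - s) - (x - y)))%:E)%E) :
  (B <= component F c x t)%E.
Proof.
apply: le_ereal_inf_tmp => _ [[y [s [_ st cone ->]]]|[_ ->]].
  have ts0 : 0 < t - s by rewrite subr_gt0.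
  rewrite convex_transform_triangular //.
  have -> : (t - s) * (fd_kc F * (fd_v F - (x - y) / (t - s))) =
      fd_kc F * (fd_v F * (t - s) - (x - y)) by field; rewrite gt_eqF.
  apply: (hB y s (ltW st)); move: cone.
  by rewrite ler_pdivlMr // ler_pdivrMr.
have := hB x t (lexx t).
by rewrite !subrr !mulr0 lexx subrr mulr0 adde0; apply.
Qed.

Lemma component_mono (R : realType) (F : fundamental_diagram R)
    (c c' : data R) (x t : R) (hF : triangular F)
    (hc : forall y s, (c y s <= c' y s)%E) :
  (component F c x t <= component F c' x t)%E.
Proof.
apply: component_ge => // y s st cone.
by apply: le_trans (component_le _ _ _ _ _ _ _ hF st cone) _; rewrite leeD2r.
Qed.

(** * Continuous piecewise affine data on a uniform time grid *)

(** Two distinct blocks meet at most at a common endpoint, where continuity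
    applies. *)
Lemma affine_pieces_agree (R : realType) (q d : nat -> R) (h : R)
    (hh : 0 < h)
    (hcont : forall m, q m * (m.+1%:R * h) + d m =
                       q m.+1 * (m.+1%:R * h) + d m.+1)
    (m n : nat) (s : R)
    (hm : m%:R * h <= s <= m.+1%:R * h)
    (hn : n%:R * h <= s <= n.+1%:R * h) :
  q m * s + d m = q n * s + d n.
Proof.
wlog mn : m n hm hn / (m < n)%N => [wl|].
  have [mn|nm|->] := ltngtP m n; [exact: wl | by rewrite (wl n m) | by []].
case/andP: hm => _ sm; case/andP: hn => ns _.
have le_mn : m.+1%:R * h <= n%:R * h by rewrite ler_pM2r // ler_nat.
have En : n = m.+1.
  by apply/eqP; rewrite eqn_leq mn andbT -(ler_nat R) -(ler_pM2r hh); lra.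
have Es : s = m.+1%:R * h by move: ns; rewrite En; lra.
by rewrite En Es hcont.
Qed.

(** The continuous function with pieces q_m s + d_m, minus M s, is
    nonincreasing since all its slopes q_m - M are nonpositive. *)
Lemma affine_pieces_slope_le (R : realType) (q d : nat -> R) (M h : R)
    (hh : 0 < h) (hq : forall m, q m <= M)
    (hcont : forall m, q m * (m.+1%:R * h) + d m =
                       q m.+1 * (m.+1%:R * h) + d m.+1)
    (m n : nat) (s s' : R)
    (hs : m%:R * h <= s <= m.+1%:R * h)
    (hs' : n%:R * h <= s' <= n.+1%:R * h) (hss' : s <= s') :
  q n * s' + d n - M * s' <= q m * s + d m - M * s.
Proof.
have [mn|nm] := leqP m n; last first.
  have hnm : n.+1%:R * h <= m%:R * h by rewrite ler_pM2r // ler_nat.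
  have ss : s' = s by lra.
  by rewrite ss in hs' *; rewrite (@affine_pieces_agree _ q d h _ _ m n).
case/andP: hs => ms sm; case/andP: hs' => ns s'n.
elim: n mn s' ns s'n hss' => [|n IH].
  rewrite leqn0 => /eqP -> s' _ _ ss.
  by have := hq 0%N; nra.
rewrite leq_eqVlt => /predU1P[->|mn] s' ns s'n ss.
  by have := hq n.+1; nra.
have le1 : n%:R * h <= n.+1%:R * h by rewrite ler_pM2r // ler_nat.
have sn : s <= n.+1%:R * h.
  by apply: le_trans sm _; rewrite ler_pM2r // ler_nat.
have := IH mn (n.+1%:R * h) le1 (lexx _) sn.
rewrite hcont; have := hq n.+1; nra.
Qed.

(** Both [up_data] and [down_data] unfold to this form. *)
Definition glued (R : realType) (x h : R) (q d : nat -> R) : data R :=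
  fun y s =>
  ereal_inf [set (if (y == x) && (m%:R * h <= s <= m.+1%:R * h)
                  then (q m * s + d m)%:E else +oo%E) | m in [set: nat]]%classic.

Lemma glued_at (R : realType) (x h : R) (q d : nat -> R)
    (hh : 0 < h)
    (hcont : forall m, q m * (m.+1%:R * h) + d m =
                       q m.+1 * (m.+1%:R * h) + d m.+1)
    (m : nat) (s : R) (hs : m%:R * h <= s <= m.+1%:R * h) :
  glued R x h q d x s = (q m * s + d m)%:E.
Proof.
rewrite /glued eqxx /=; apply/le_anti/andP; split.
  by apply: ereal_inf_lbound; exists m => //; rewrite hs.
apply: le_ereal_inf_tmp => _ [n _ <-]; case: ifPn => [hn|_]; last exact: leey.
by rewrite (@affine_pieces_agree _ q d h hh hcont m n).
Qed.

Lemma glued_spec (R : realType) (x h : R) (q d : nat -> R) (y s : R)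
    (hh : 0 < h)
    (hcont : forall m, q m * (m.+1%:R * h) + d m =
                       q m.+1 * (m.+1%:R * h) + d m.+1) :
  (exists m, [/\ y = x, m%:R * h <= s <= m.+1%:R * h
                & glued R x h q d y s = (q m * s + d m)%:E]) \/
  glued R x h q d y s = +oo%E.
Proof.
have [[m /andP[/eqP -> hs]]|none] :=
    pselect (exists m, (y == x) && (m%:R * h <= s <= m.+1%:R * h)).
  by left; exists m; rewrite (@glued_at _ _ _ _ _ _ _ m).
right; apply/eqP; rewrite eq_le leey /=.
apply: le_ereal_inf_tmp => _ [n _ <-]; case: ifPn => // hn.
by case: none; exists n.
Qed.

(** * Contributions of the data at the upstream end *)

Section Link.
Variables (R : realType) (F : fundamental_diagram R) (D : link_data R) (dx : R).
Hypotheses (hF : triangular F) (hn : (0 < n_ini D)%N) (hdx : 0 < dx)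
  (hdt : 0 < dt D)
  (hgrid : forall m, (m <= n_ini D)%N -> node D m = node D 0%N + m%:R * dx)
  (hcoef : admissible_coefficients F D) (hcont : continuous_data D).

Local Notation v := (fd_v F).
Local Notation w := (fd_w F).
Local Notation kc := (fd_kc F).

Lemma time_ge0 m : 0 <= time D m.
Proof. by rewrite mulr_ge0 // ltW. Qed.

Lemma timeS m : time D m.+1 = time D m + dt D.
Proof. by rewrite /time mulrS; ring. Qed.

Lemma time_block m : time D m <= time D m <= time D m.+1.
Proof. by rewrite lexx timeS lerDl ltW. Qed.

Lemma up_data_at m s : time D m <= s <= time D m.+1 ->
  up_data D (x_up D) s = (up_affine D m s)%:E.
Proof. by case: hcont => _ cu _ _ _; exact: glued_at. Qed.

Lemma down_data_at m s : time D m <= s <= time D m.+1 ->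
  down_data D (x_down D) s = (down_affine D m s)%:E.
Proof. by case: hcont => _ _ cd _ _; exact: glued_at. Qed.

Lemma up_data_spec y s :
  (exists m, [/\ y = x_up D, time D m <= s <= time D m.+1
                & up_data D y s = (up_affine D m s)%:E]) \/
  up_data D y s = +oo%E.
Proof. by case: hcont => _ cu _ _ _; exact: glued_spec. Qed.

Lemma down_data_spec y s :
  (exists m, [/\ y = x_down D, time D m <= s <= time D m.+1
                & down_data D y s = (down_affine D m s)%:E]) \/
  down_data D y s = +oo%E.
Proof. by case: hcont => _ _ cd _ _; exact: glued_spec. Qed.

Definition upstream_value (i : nat) : R :=
  up_affine D i (time D i) + v * kc * dt D.

(** As q_m <= v kc, the contribution of the upstream data decreases with
    their time, so the latest admitted time is optimal. *)
Lemma component_up_until i :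
  component F (until (time D i) (up_data D)) (x_up D) (time D i.+1) =
  (upstream_value i)%:E.
Proof.
have [v0 w0 k0 _ _] := hF; have [_ cu _ _ _] := hcont; have [_ qb _] := hcoef.
apply/le_anti/andP; split.
  have cone : - w * (time D i.+1 - time D i) <= x_up D - x_up D <=
      v * (time D i.+1 - time D i).
    rewrite subrr timeS addrAC subrr add0r mulNr oppr_le0.
    by rewrite !mulr_ge0 // ltW.
  have le_i : time D i <= time D i.+1 by case/andP: (time_block i).
  apply: le_trans (component_le _ _ _ _ _ _ _ hF le_i cone) _.
  rewrite /until lexx (up_data_at i) ?time_block // -EFinD lee_fin timeS.
  by rewrite /upstream_value; lra.
apply: component_ge => // y s _ _; rewrite /until.
case: ifPn => [si|_]; last by rewrite addye ?leey.
have [[m [-> hm ->]]|->] := up_data_spec y s; last by rewrite addye ?leey.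
rewrite -EFinD lee_fin /upstream_value timeS.
have qM n : up_q D n <= v * kc by case/andP: (qb n).
have := @affine_pieces_slope_le _ _ _ _ _ hdt qM cu m i s (time D i) hm
  (time_block i) si.
by rewrite -/(up_affine D i _) -/(up_affine D m _); nra.
Qed.

(** At the initial time of a block only the point itself is in the cone. *)
Lemma component_up_block_start i :
  component F (up_block D i) (x_up D) (time D i) = (up_affine D i (time D i))%:E.
Proof.
have [v0 w0 k0 _ _] := hF.
apply/le_anti/andP; split.
  have cone : - w * (time D i - time D i) <= x_up D - x_up D <=
      v * (time D i - time D i) by rewrite !subrr !mulr0 lexx.
  apply: le_trans (component_le _ _ _ _ _ _ _ hF (lexx _) cone) _.
  by rewrite /up_block eqxx time_block !subrr !mulr0 subrr mulr0 adde0.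
apply: component_ge => // y s si _; rewrite /up_block.
case: ifPn => [/and3P[/eqP -> si' _]|_]; last by rewrite addye ?leey.
have -> : s = time D i by apply/le_anti/andP.
by rewrite !subrr !mulr0 subrr mulr0 adde0.
Qed.

(** What the extension of the affine datum of block m contributes at y to the
    component at (x_up, t). *)
Definition ini_value (m : nat) (t y : R) : R :=
  ini_affine D m y + kc * (v * t + (y - x_up D)).

Lemma ini_component_le m t y :
  node D m <= y <= node D m.+1 -> 0 <= t -> 0 <= y - x_up D <= w * t ->
  (component F (ini_block D m) (x_up D) t <= (ini_value m t y)%:E)%E.
Proof.
have [v0 w0 k0 _ _] := hF.
move=> hy t0 /andP[y0 yw].
have cone : - w * (t - 0) <= x_up D - y <= v * (t - 0).
  by rewrite subr0; apply/andP; split; nra.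
apply: le_trans (component_le _ _ _ _ _ _ _ hF t0 cone) _.
by rewrite /ini_block eqxx hy -EFinD lee_fin /ini_value subr0; nra.
Qed.

Lemma ini_component_ge m t (B : \bar R) :
  (forall y, node D m <= y <= node D m.+1 -> y - x_up D <= w * t ->
     (B <= (ini_value m t y)%:E)%E) ->
  (B <= component F (ini_block D m) (x_up D) t)%E.
Proof.
move=> hB; apply: component_ge => // y s _ /andP[cone _]; rewrite /ini_block.
case: ifPn => [/andP[/eqP s0 hy]|_]; last by rewrite addye ?leey.
rewrite s0 subr0 in cone *.
apply: le_trans (hB y hy _) _; first by lra.
by rewrite -EFinD lee_fin /ini_value; nra.
Qed.

(** * Comparisons between contributions *)

Lemma nodeE m : (m <= n_ini D)%N -> node D m = x_up D + m%:R * dx.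
Proof. exact: hgrid. Qed.

Lemma link_length : x_down D = x_up D + (n_ini D)%:R * dx.
Proof. exact: nodeE. Qed.

Lemma x_up_le_x_down : x_up D <= x_down D.
Proof. by rewrite link_length lerDl mulr_ge0 // ltW. Qed.

Lemma x_up_le_node m : (m <= n_ini D)%N -> x_up D <= node D m.
Proof. by move=> hm; rewrite nodeE // lerDl mulr_ge0 // ltW. Qed.

(** From time t_i to time t_{i+1} both sides grow by v kc dt, so it suffices to
    compare them at t_i.  There the bound of the upstream data by the supply
    applies if i > 0, and the continuity at the corner (x_0, 0) if i = 0. *)
Lemma upstream_le_ini (hflow : flows_from_junctions F D) i m y :
  (m < n_ini D)%N -> node D m <= y <= node D m.+1 ->
  y - x_up D <= w * time D i -> upstream_value i <= ini_value m (time D i.+1) y.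
Proof.
move=> mn hy yw; have [v0 w0 k0 _ _] := hF.
have ym : x_up D <= y.
  by case/andP: (hy) => + _; apply: le_trans; rewrite x_up_le_node // ltnW.
rewrite /upstream_value timeS.
suff : up_affine D i (time D i) <= ini_value m (time D i) y.
  by rewrite /ini_value; nra.
case: i yw => [|i] yw.
  have Ey : y = x_up D by move: yw; rewrite /time mul0r mulr0; lra.
  have Em : m = 0%N.
    apply/eqP; rewrite -leqn0 -(ler_nat R) -(ler_pM2r hdx) mul0r.
    by case/andP: hy; rewrite Ey nodeE ?(ltnW mn) // gerDl.
  have [_ _ _ cu0 _] := hcont.
  by rewrite Ey Em /ini_value /time !mul0r cu0 mulr0 subrr addr0 mulr0 addr0.
rewrite -lee_fin -(up_data_at i.+1) ?time_block //.
apply: le_trans (hflow.1 i.+1 isT) _.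
rewrite /N_supply ge_min; apply/orP; left.
apply: le_trans (bigmin_le _ (Ordinal mn) _) _.
by apply: ini_component_le; rewrite ?time_ge0 // subr_ge0 ym.
Qed.

(** As p_m <= v kc, the contribution of the downstream data decreases with
    their time, so the latest time at which a wave of speed -w can leave x_down
    and reach x_up by time t is optimal. *)
Lemma component_down_block k t :
  time D k <= t - (x_down D - x_up D) / w <= time D k.+1 ->
  component F (down_data D) (x_up D) t = component F (down_block D k) (x_up D) t.
Proof.
have [v0 w0 k0 _ _] := hF; have [_ _ cd _ _] := hcont; have [_ _ pb] := hcoef.
have x01 := x_up_le_x_down.
set L := x_down D - x_up D => hk.
have L0 : 0 <= L by rewrite subr_ge0.
have T0 : 0 <= L / w by rewrite divr_ge0 // ltW.
have wT : w * (L / w) = L by rewrite mulrC divfK // gt_eqF.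
apply/le_anti/andP; split.
  apply: component_mono => // y s.
  by apply: ereal_inf_lbound; exists k.
have sle : t - L / w <= t by rewrite gerBl.
have cone : - w * (t - (t - L / w)) <= x_up D - x_down D <=
    v * (t - (t - L / w)).
  rewrite subKr mulNr wT opprB lexx.
  by apply: (@le_trans _ _ 0); rewrite ?subr_le0 // mulr_ge0 // ltW.
apply: le_trans (component_le _ _ _ _ _ _ _ hF sle cone) _.
rewrite /down_block eqxx hk -EFinD.
apply: component_ge => // y s _ cone'.
have [[m [Ey hm ->]]|->] := down_data_spec y s; last by rewrite addye ?leey.
rewrite -EFinD lee_fin Ey.
have pM n : down_p D n <= v * kc by case/andP: (pb n).
have ss : s <= t - L / w.
  rewrite -(ler_pM2l w0) mulrBr wT; case/andP: cone' => + _.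
  by rewrite Ey /L; nra.
have := @affine_pieces_slope_le _ _ _ _ _ hdt pM cd m k s (t - L / w) hm hk ss.
by rewrite -/(down_affine D k _) -/(down_affine D m _); nra.
Qed.

Lemma down_affine_time0 :
  down_affine D 0 (time D 0) = ini_affine D (n_ini D).-1 (x_down D).
Proof. by case: hcont => _ _ _ _ <-; rewrite /time mul0r. Qed.

(** The corner (x_down, 0) carries an initial and a downstream datum, which
    agree by continuity. *)
Lemma component_down_le_ini_end t :
  (x_down D - x_up D) / w <= t ->
  (component F (down_data D) (x_up D) t <=
   (ini_value (n_ini D).-1 t (x_down D))%:E)%E.
Proof.
have [v0 w0 k0 _ _] := hF; have x01 := x_up_le_x_down.
rewrite ler_pdivrMr // => Tt.
have t0 : 0 <= t by rewrite -(pmulr_lge0 _ w0); lra.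
have cone : - w * (t - time D 0) <= x_up D - x_down D <= v * (t - time D 0).
  by rewrite /time mul0r subr0; apply/andP; split; nra.
have le0t : time D 0 <= t by rewrite /time mul0r.
apply: le_trans (component_le _ _ _ _ _ _ _ hF le0t cone) _.
rewrite (down_data_at 0) ?time_block // down_affine_time0 -EFinD lee_fin.
by rewrite /ini_value /time mul0r subr0; nra.
Qed.

Lemma last_node : node D (n_ini D).-1.+1 = x_down D.
Proof. by rewrite prednK. Qed.

(** A wave leaving x_down after time 0 arrives at x_up after time T, so up to
    time T at most the corner (x_down, 0) is seen. *)
Lemma ini_end_le_component_down t :
  t <= (x_down D - x_up D) / w ->
  (component F (down_data D) (x_up D) t = +oo)%E \/
  t = (x_down D - x_up D) / w /\
  (component F (ini_block D (n_ini D).-1) (x_up D) t <=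
   component F (down_data D) (x_up D) t)%E.
Proof.
have [v0 w0 k0 _ _] := hF; have x01 := x_up_le_x_down.
rewrite le_eqVlt => /predU1P[Et|tT].
  right; split => //.
  apply: component_ge => // y s _ cone.
  have [[m [Ey hm ->]]|->] := down_data_spec y s; last by rewrite addye ?leey.
  have wt : w * t = x_down D - x_up D by rewrite Et mulrC divfK // gt_eqF.
  have s0 : s = 0.
    have := time_ge0 m; case/andP: hm; case/andP: cone; rewrite Ey; nra.
  have m0 : m = 0%N.
    apply/eqP; rewrite -leqn0 -(ler_nat R) -(ler_pM2r hdt) mul0r -s0.
    by case/andP: hm.
  rewrite m0 s0 Ey.
  have -> : down_affine D 0 0 = ini_affine D (n_ini D).-1 (x_down D).
    by rewrite -down_affine_time0 /time mul0r.
  rewrite -EFinD.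
  have t0 : 0 <= t by rewrite Et divr_ge0 ?subr_ge0 // ltW.
  have hy : node D (n_ini D).-1 <= x_down D <= node D (n_ini D).-1.+1.
    rewrite last_node lexx andbT link_length nodeE ?leq_pred // lerD2l.
    by rewrite ler_pM2r // ler_nat leq_pred.
  have hw : 0 <= x_down D - x_up D <= w * t by rewrite subr_ge0 x01 wt lexx.
  apply: le_trans (@ini_component_le _ t _ hy t0 hw) _.
  by rewrite lee_fin /ini_value subr0; nra.
left; apply/eqP; rewrite eq_le leey /=.
apply: component_ge => // y s _ /andP[cone _].
have [[m [Ey /andP[hm _] _]]|->] := down_data_spec y s; last by rewrite addye.
exfalso; move: tT; rewrite ltr_pdivlMr // => tT.
by have := time_ge0 m; rewrite Ey in cone; nra.
Qed.

(** * The supply *)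

Lemma N_supply_ge i (B : \bar R) :
  (forall m, (m < n_ini D)%N ->
     (B <= component F (ini_block D m) (x_up D) (time D i.+1))%E) ->
  (B <= component F (down_data D) (x_up D) (time D i.+1))%E ->
  (B <= (upstream_value i)%:E)%E ->
  (B <= N_supply F D i.+1)%E.
Proof.
move=> hini hdown hup; rewrite /N_supply !le_min component_up_until hdown hup.
by rewrite !andbT; apply: le_bigmin; [exact: leey | move=> m _; exact: hini].
Qed.

Lemma N_supply_le_ini i m t :
  t = time D i.+1 -> (N_supply F D i.+1 <= N_ini F D m (x_up D) t)%E.
Proof.
move=> ->; case: m => [m|m] /=; last exact: leey.
case: ifP => [mn|_]; last exact: leey.
rewrite /N_supply ge_min; apply/orP; left.
exact: (bigmin_le _ (Ordinal mn) _).
Qed.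

(** Points within the reach w t_i contribute at least the upstream value.  Since
    w t_{i+1} exceeds the length of the link and w dt <= dx, the last block
    begins within this reach and contains every point y beyond it.  As a function of y its contribution has slope kc - k_m: if this is
    nonpositive, moving y to x_down decreases the contribution to one that the
    downstream data also have; otherwise moving y to the left end of the block
    decreases it to one that is bounded below by the upstream data. *)
Lemma ini_ge_min_up_down (hflow : flows_from_junctions F D)
    (hdtw : dt D <= dx / w) i m :
  (x_down D - x_up D) / w < time D i.+1 -> (m < n_ini D)%N ->
  (Order.min (upstream_value i)%:E
     (component F (down_data D) (x_up D) (time D i.+1)) <=
   component F (ini_block D m) (x_up D) (time D i.+1))%E.
Proof.
have [v0 w0 k0 _ _] := hF => Tt mn.
apply: ini_component_ge => y hy _; rewrite ge_min; apply/orP.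
have [yi|iy] := leP (y - x_up D) (w * time D i).
  by left; rewrite lee_fin upstream_le_ini.
have wdt : w * dt D <= dx by rewrite mulrC -ler_pdivlMr.
have Lt : (n_ini D)%:R * dx < w * (time D i + dt D).
  by move: Tt; rewrite ltr_pdivrMr // timeS link_length; nra.
have Em : m.+1 = n_ini D.
  apply/eqP; rewrite eqn_leq mn /= leqNgt; apply/negP => mn'.
  have : m.+2%:R * dx <= (n_ini D)%:R * dx by rewrite ler_pM2r // ler_nat.
  by case/andP: hy => _; rewrite nodeE // -(natr1 m.+1); nra.
have Em1 : m = (n_ini D).-1 by rewrite -Em.
have [kck|kkc] := leP kc (ini_k D m).
  right; apply: le_trans (component_down_le_ini_end _ (ltW Tt)) _.
  have := hy; rewrite Em1 last_node -Em1 => /andP[_ yL].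
  by rewrite lee_fin /ini_value /ini_affine; nra.
left; rewrite lee_fin.
have hm : node D m <= node D m <= node D m.+1.
  by rewrite lexx; case/andP: hy; exact: le_trans.
have mi : node D m - x_up D <= w * time D i.
  by move: Lt; rewrite nodeE ?(ltnW mn) // -Em -natr1; nra.
apply: le_trans (upstream_le_ini hflow i m _ mn hm mi) _.
by case/andP: hy => my _; rewrite /ini_value /ini_affine; nra.
Qed.

End Link.

Lemma floor_nat (R : realType) (x : R) :
  0 <= x -> exists n : nat, Num.floor x = n%:Z /\ n%:R <= x < n.+1%:R.
Proof.
rewrite -floor_ge0; have := floor_itv x.
case: (Num.floor x) => [n|//] hx _; exists n; split => //.
by move: hx; rewrite -[X in (_ + X)%R]/(1%:Z) -PoszD addn1.
Qed.

Theorem corollary3 (R : realType) (F : fundamental_diagram R)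
    (D : link_data R) (dx : R) (i : nat)
    (hF : triangular F)
    (hn : (0 < n_ini D)%N)
    (hdx : 0 < dx) (hdt : 0 < dt D)
    (hgrid : forall m, (m <= n_ini D)%N -> node D m = node D 0%N + m%:R * dx)
    (hcoef : admissible_coefficients F D)
    (hcont : continuous_data D)
    (hflow : flows_from_junctions F D)
    (hdtv : dt D <= dx / fd_v F)
    (hdtw : dt D <= dx / fd_w F)
    (hi : (1 <= i)%N) :
  let t := time D i in
  let T := (x_down D - x_up D) / fd_w F in
  let j := i%:Z - 1 in
  let k := Num.floor ((t - T) / dt D) in
  let l := Num.floor (fd_w F * t / dx) in
  let upstream :=
    (N_up F D j (x_up D) (time D i.-1) + (fd_v F * fd_kc F * dt D)%:E)%E in
  N_supply F D i =
    if t <= T then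
      Order.min (N_ini F D l (x_up D) t)
        (Order.min (N_ini F D (l - 1) (x_up D) t) upstream)
    else Order.min upstream (N_down F D k (x_up D) t).
Proof.
move=> t T j k l upstream.
case: i hi @t @j @k @l @upstream => [//|i] _ t j k l.
have -> : j = i%:Z by rewrite /j -addn1 PoszD addrK.
have [v0 w0 k0 _ _] := hF.
have wdt : fd_w F * dt D <= dx by rewrite mulrC -ler_pdivlMr.
rewrite /N_up /= component_up_block_start // -EFinD -/(upstream_value _ F D i).
set U := upstream_value _ _ _ _.
have NU : (N_supply F D i.+1 <= U%:E)%E.
  by rewrite /N_supply component_up_until // !ge_min lexx !orbT.
have ND : (N_supply F D i.+1 <= component F (down_data D) (x_up D) t)%E.
  by rewrite /N_supply !ge_min lexx !orbT.
case: leP => [tT|Tt]; last first.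
  have q0 : 0 <= (t - T) / dt D by rewrite divr_ge0 ?subr_ge0 // ltW.
  have [k' [Ek /andP[kl ku]]] := @floor_nat R _ q0.
  rewrite ler_pdivlMr // in kl; rewrite ltr_pdivrMr // in ku.
  have hk : time D k' <= t - T <= time D k'.+1 by rewrite /time kl ltW.
  rewrite /k Ek /= -(component_down_block R F D dx hF hdx hdt hgrid hcoef hcont
    k' t hk).
  apply/le_anti/andP; split; first by rewrite le_min NU ND.
  apply: N_supply_ge => // [m mn||].
  - exact: (ini_ge_min_up_down _ _ _ dx).
  - by rewrite ge_min lexx orbT.
  - by rewrite ge_min lexx.
apply/le_anti/andP; split.
- by rewrite !le_min NU !N_supply_le_ini.
- have t0 : 0 <= t by exact: time_ge0.
  have wt0 : 0 <= fd_w F * t / dx by rewrite !mulr_ge0 ?invr_ge0 // ltW.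
  have [l' [El /andP[ll lu]]] := @floor_nat R _ wt0.
  rewrite ler_pdivlMr // in ll; rewrite ltr_pdivrMr // in lu.
  apply: N_supply_ge => // [m mn||]; last by rewrite !ge_min lexx !orbT.
    have [ml|lm|ml] := ltngtP m l'; last first.
    + by rewrite /l El -ml /= mn ge_min lexx.
    + apply: ini_component_ge => // y /andP[my _] yt; exfalso.
      (* A block m > l begins after x_0 + w t, outside the cone. *)
      have : l'.+1%:R * dx <= m%:R * dx by rewrite ler_pM2r // ler_nat.
      by move: my; rewrite (nodeE _ D dx) ?(ltnW mn) // -/t in yt *; lra.
    have [ml1|lm1] := ltnP m.+1 l'.
      (* A block m < l - 1 ends at x_{l-1} or before, and x_{l-1} - x_0 is at
         most w t - dx, hence at most w (t - dt). *)
      rewrite !ge_min; apply/orP; right; apply/orP; right.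
      apply: ini_component_ge => // y hy yt.
      rewrite lee_fin (upstream_le_ini _ _ _ dx) //.
      have : m.+2%:R * dx <= l'%:R * dx by rewrite ler_pM2r // ler_nat.
      case/andP: hy => _; rewrite (nodeE _ D dx) // -(natr1 m.+1).
      by move: ll; rewrite /t timeS mulrDr; lra.
    have -> : l = m.+1%:Z by rewrite /l El; lia.
    by rewrite -addn1 PoszD addrK /= mn !ge_min lexx orbT.
  have [->|[tT' le]] := ini_end_le_component_down R F D dx hF hn hdx hdt
    hgrid hcont t tT; first exact: leey.
  (* At t = T the index l is n, so N_{l-1} is the last block and N_l is +oo. *)
  have wt : fd_w F * t = (n_ini D)%:R * dx.
    by rewrite tT' mulrC divfK ?gt_eqF // (link_length _ D dx) // addrC addKr.
  have ln : l = (n_ini D).-1.+1%:Z.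
    rewrite /l wt mulfK ?gt_eqF // prednK //; exact: (intrKfloor (n_ini D)%:Z).
  apply: le_trans le.
  by rewrite ln -addn1 PoszD addrK /= ltn_predL hn !ge_min lexx orbT.
Qed.
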